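(* Let $(M,+,0,E)$ be a flow domain and $\mathfrak{N}$ a set of nodes. Let $I, I_1, I_2, I_1'$ be flow interfaces such that $I = I_1\oplus I_2$ (in particular this composition is defined), $I_1 \precsim I_1'$, the domains of $I_1'$ and $I_2$ are disjoint, and $\mathit{out}_{I_2}(n)=0$ for every $n$ in the domain of $I_1'$ that is not in the domain of $I_1$. Then $I' := I_1'\oplus I_2$ is defined and $I\precsim I'$.
   Context: A flow domain $(M,+,0,E)$ consists of a commutative cancellative monoid $(M,+,0)$ and a set $E$ of functions $M\to M$. Fix a set of nodes $\mathfrak{N}$. A flow interface is a pair $I=(\mathit{in},\mathit{out})$ with $\mathit{in}\colon N\to M$ and $\mathit{out}\colon\mathfrak{N}\setminus N\to M$ for some $N\subseteq\mathfrak{N}$ (the domain of $I$); write $\mathit{in}_I,\mathit{out}_I$ for its components. The composition $I_1\oplus I_2$ is defined iff the domains of $I_1,I_2$ are disjoint and there is an interface $I$ with domain equal to their union such that for all $i\neq j\in\{1,2\}$ and $n$ in the domain of $I_i$, $\mathit{in}_{I_i}(n)=\mathit{in}_I(n)+\mathit{out}_{I_j}(n)$, and for all $n$ outside the domain of $I$, $\mathit{out}_I(n)=\mathit{out}_{I_1}(n)+\mathit{out}_{I_2}(n)$; then $I_1\oplus I_2:=I$ (unique by cancellativity). An interface $I=(\mathit{in},\mathit{out})$ is contextually extended by $I'=(\mathit{in}',\mathit{out}')$, written $I\precsim I'$, iff (1) $\mathrm{dom}(\mathit{in})\subseteq\mathrm{dom}(\mathit{in}')$, (2) $\mathit{in}(n)=\mathit{in}'(n)$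 for all $n\in\mathrm{dom}(\mathit{in})$, and (3) $\mathit{out}(n')=\mathit{out}'(n')$ for all $n'\notin\mathrm{dom}(\mathit{in}')$. *)

(* Defs.v *)
From HB Require Import structures.
From mathcomp Require Import all_boot ssralg.
From mathcomp Require Import boolp classical_sets.

Set Implicit Arguments.
Unset Strict Implicit.
Unset Printing Implicit Defensive.

Import GRing.Theory.
Local Open Scope classical_set_scope.
Local Open Scope ring_scope.

(* [nmodType] also asks for a choice structure on the carrier, which every type
   has classically (see [boolp]). *)
Record flowDomain : Type := FlowDomain {
  flow_monoid :> nmodType;
  flow_addI : right_injective (+%R : flow_monoid -> flow_monoid -> flow_monoid);
  flow_edges : set (flow_monoid -> flow_monoid)
}.

(* A set [N : set node] used as a type is the subtype [{n | n \in N}]; its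
   elements are written [SigSub h] with [h : n \in N], and since [n \in N] is
   boolean they do not depend on the choice of [h]. *)
Record flow_interface (D : flowDomain) (node : Type) : Type := FlowInterface {
  fi_dom : set node;
  fi_in : fi_dom -> D;
  fi_out : ~` fi_dom -> D
}.

Section Interfaces.
Variables (D : flowDomain) (node : Type).
Implicit Types I J : flow_interface D node.

(* The membership proofs quantified below all exist, by the conditions on the
   domains stated first. *)
Definition is_fi_comp I1 I2 I : Prop :=
  [/\ fi_dom I1 `&` fi_dom I2 = set0,
      fi_dom I = fi_dom I1 `|` fi_dom I2,
      forall n (h : n \in fi_dom I) (h1 : n \in fi_dom I1)
        (h2 : n \in ~` fi_dom I2),
        fi_in (SigSub h1) = fi_in (SigSub h) + fi_out (SigSub h2),
      forall n (h : n \in fi_dom I) (h1 : n \in ~` fi_dom I1)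
        (h2 : n \in fi_dom I2),
        fi_in (SigSub h2) = fi_in (SigSub h) + fi_out (SigSub h1) &
      forall n (h : n \in ~` fi_dom I) (h1 : n \in ~` fi_dom I1)
        (h2 : n \in ~` fi_dom I2),
        fi_out (SigSub h) = fi_out (SigSub h1) + fi_out (SigSub h2)].

Lemma is_fi_comp_uniq I1 I2 I J :
  is_fi_comp I1 I2 I -> is_fi_comp I1 I2 J -> I = J.
Proof.
move: I J => [A iA oA] [B iB oB] [/= dj eA inA1 inA2 outA].
move=> [/= _ eB inB1 inB2 outB].
have dj12 n : n \in fi_dom I1 -> n \in ~` fi_dom I2.
  rewrite !inE /= => n1 n2; suff: set0 n by [].
  by rewrite -dj.
have dj21 n : n \in fi_dom I2 -> n \in ~` fi_dom I1.
  rewrite !inE /= => n2 n1; suff: set0 n by [].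
  by rewrite -dj.
have AB : A = B by rewrite eA eB.
rewrite -{}AB {B} in iB oB eB inB1 inB2 outB *.
have -> : iA = iB.
  apply/funext => -[n h].
  have : n \in fi_dom I1 `|` fi_dom I2 by rewrite -eA.
  rewrite inE => -[] /mem_set h12.
    have := inB1 n h h12 (dj12 n h12); rewrite (inA1 n h h12 (dj12 n h12)).
    by rewrite ![_ + fi_out _]addrC => /flow_addI.
  have := inB2 n h (dj21 n h12) h12; rewrite (inA2 n h (dj21 n h12) h12).
  by rewrite ![_ + fi_out _]addrC => /flow_addI.
suff -> : oA = oB by [].
apply/funext => -[n h].
have : n \in ~` (fi_dom I1 `|` fi_dom I2) by rewrite -eA.
rewrite setCU inE => -[/mem_set h1 /mem_set h2].
by rewrite (outA n h h1 h2) -(outB n h h1 h2).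
Qed.

(* [None] stands for an undefined composition. *)
Definition fi_comp I1 I2 : option (flow_interface D node) :=
  if pselect (exists I, is_fi_comp I1 I2 I) is left h then Some (sval (cid h))
  else None.

Lemma fi_compP I1 I2 I : fi_comp I1 I2 = Some I <-> is_fi_comp I1 I2 I.
Proof.
rewrite /fi_comp; case: pselect => [h|h]; split.
- by move=> [<-]; exact: svalP (cid h).
- by move=> hI; congr Some; apply: is_fi_comp_uniq (svalP (cid h)) hI.
- by [].
- by move=> hI; case: h; exists I.
Qed.

Definition ctx_ext I J : Prop :=
  [/\ fi_dom I `<=` fi_dom J,
      forall n (h : n \in fi_dom I) (h' : n \in fi_dom J),
        fi_in (SigSub h) = fi_in (SigSub h') &
      forall n (h : n \in ~` fi_dom I) (h' : n \in ~` fi_dom J),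
        fi_out (SigSub h) = fi_out (SigSub h')].

End Interfaces.

(* Main.v *)
(* On the domain of [I] the composite [I1' (+) I2] must have the inflow of [I];
   on the nodes gained by [I1'] it must have the inflow of [I1'], since [I2]
   sends nothing there.  Its outflow is the sum of the two outflows, which agrees
   with that of [I] because [I1] and [I1'] have the same outflow outside the
   domain of [I1']. *)

Require Import Defs.
From mathcomp Require Import all_boot ssralg.
From mathcomp Require Import boolp classical_sets.

Import GRing.Theory.
Local Open Scope classical_set_scope.
Local Open Scope ring_scope.

(** Totalizes a function on a subtype, so that [in'] and [out'] can be written without membership
    proofs. They only evaluate it inside [A], so the default 0 is never reached. *)
Definition extend0 (V : nmodType) (T : Type) (A : set T) (f : A -> V) (n : T) : V :=
  if pselect (n \in A) is left h then f (SigSub h) else 0.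

Arguments extend0 {V T A} f n.

Lemma extend0E (V : nmodType) (T : Type) (A : set T) (f : A -> V) (n : T)
  (h : n \in A) : extend0 f n = f (SigSub h).
Proof.
rewrite /extend0; case: pselect => [h'|//].
by rewrite (bool_irrelevance h' h).
Qed.

Arguments extend0E {V T A f n} h.

Theorem theorem2 (D : flowDomain) (node : Type)
    (I I1 I2 I1' : flow_interface D node)
    (hI : fi_comp I1 I2 = Some I)
    (hI1 : ctx_ext I1 I1')
    (hdisj : fi_dom I1' `&` fi_dom I2 = set0)
    (hout : forall n (h : n \in ~` fi_dom I2),
      n \in fi_dom I1' -> n \notin fi_dom I1 -> fi_out (SigSub h) = 0) :
  exists I' : flow_interface D node,
    fi_comp I1' I2 = Some I' /\ ctx_ext I I'.
Proof.
move/fi_compP: hI => [_ domI inI1 inI2 outI].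
case: hI1 => dom_sub in_ext out_ext.
have notin_I1 n : n \in ~` fi_dom I1' -> n \in ~` fi_dom I1.
  by rewrite !inE => n1' /dom_sub.
have mem_I n : (n \in fi_dom I) = (n \in fi_dom I1) || (n \in fi_dom I2).
  by rewrite domI in_setU.
pose dom' := fi_dom I1' `|` fi_dom I2.
pose in' (x : dom') : D := if sval x \in fi_dom I
  then extend0 (@fi_in _ _ I) (sval x)
  else extend0 (@fi_in _ _ I1') (sval x).
pose out' (x : ~` dom') : D := extend0 (@fi_out _ _ I1') (sval x)
  + extend0 (@fi_out _ _ I2) (sval x).
exists (@FlowInterface D node dom' in' out'); split.
- apply/fi_compP; split => //= n.
  + move=> h h1' h2; rewrite /in' /=; case: ifPn => [nI|nI].
      (* A node of [I] outside [I2] lies in [I1], where [I1'] has the inflow of [I1]. *)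
      have h1 : n \in fi_dom I1.
        by move: nI h2; rewrite mem_I in_setC => /orP[//|->].
      by rewrite (extend0E nI) -(in_ext n h1) (inI1 n nI h1 h2).
    (* Here [n] is gained by [I1'], so [hout] cancels the term from [I2]. *)
    move: nI; rewrite mem_I negb_or => /andP[n1 _].
    by rewrite (extend0E h1') hout // addr0.
  + move=> h h1' h2; have nI : n \in fi_dom I by rewrite mem_I h2 orbT.
    rewrite /in' /= nI (extend0E nI).
    (* As [n] is outside [I1'], it receives the same flow from [I1] and from [I1']. *)
    by rewrite (inI2 n nI (notin_I1 n h1') h2) (out_ext n _ h1').
  + by move=> h h1' h2; rewrite /out' /= (extend0E h1') (extend0E h2).
- split => /= [|n h h'|n h h'].
  + by rewrite domI => n [/dom_sub|]; [left|right].
  + by rewrite /in' /= h (extend0E h).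
  + have /andP[h1' h2] : (n \in ~` fi_dom I1') && (n \in ~` fi_dom I2).
      by rewrite -in_setI -setCU.
    rewrite /out' /= (extend0E h1') (extend0E h2).
    by rewrite (outI n h (notin_I1 n h1') h2) (out_ext n _ h1').
Qed.
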